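(* For every integer $N \geq 1$, there exists a constant $C = C(N)$ (depending only on $N$) such that for any $s_1 \in (0,1)$ and $p_1 \in (1,\infty)$ with $s_1 p_1 \geq 1$, and for any $\theta \in (0,1)$, we have $$\left[ \frac{u(x) - u(y)}{|x-y|^{\frac{N}{p} + s}} \right]_{M^p(\mathbb{R}^N \times \mathbb{R}^N)} \leq C \, |u|_{W^{s_1,p_1}(\mathbb{R}^N)}^{\theta} \, \|\nabla u\|_{L^1(\mathbb{R}^N)}^{1-\theta} \qquad \text{for all } u \in C^\infty_c(\mathbb{R}^N),$$ where $0 < s < 1$ and $1 < p < \infty$ are defined by $$s = \theta s_1 + (1-\theta) \qquad \text{and} \qquad \frac{1}{p} = \frac{\theta}{p_1} + (1-\theta).$$
   Context: $C^\infty_c(\mathbb{R}^N)$ is the space of (real-valued) smooth compactly supported functions on $\mathbb{R}^N$, and $\|\nabla u\|_{L^1(\mathbb{R}^N)} = \int_{\mathbb{R}^N} |\nabla u(x)| \, dx$ with $|\cdot|$ the Euclidean norm. For $0 < \sigma < 1$ and $1 \le q < \infty$, the Gagliardo semi-norm is defined by $$|u|_{W^{\sigma,q}(\mathbb{R}^N)}^q := \iint_{\mathbb{R}^N \times \mathbb{R}^N} \frac{|u(x)-u(y)|^q}{|x-y|^{N + \sigma q}} \, dx \, dy.$$ For $1 \le p < \infty$, the Marcinkiewicz (weak $L^p$) quasi-norm of a measurable function $f$ on $\mathbb{R}^N \times \mathbb{R}^N$ is defined by $$[f]_{M^p(\mathbb{R}^N \times \mathbb{R}^N)}^p := \sup_{\lambda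 > 0} \lambda^p \, \mathcal{L}^{2N}\bigl(\{ (x,y) \in \mathbb{R}^N \times \mathbb{R}^N : |f(x,y)| \geq \lambda \}\bigr),$$ where $\mathcal{L}^{2N}$ is Lebesgue measure on $\mathbb{R}^N \times \mathbb{R}^N$. The quotient in the claim is regarded as a function of $(x,y)$ defined for $x \neq y$ (the diagonal has measure zero). *)

(* Defs.v *)
From HB Require Import structures.
From mathcomp Require Import all_boot all_order all_algebra.
From mathcomp Require Import all_classical all_reals all_analysis.
From mathcomp Require Import measurable_realfun.

Set Implicit Arguments.
Unset Strict Implicit.
Unset Printing Implicit Defensive.

Import Order.TTheory GRing.Theory Num.Theory.
Import numFieldNormedType.Exports.

Local Open Scope classical_set_scope.
Local Open Scope ring_scope.

(* 'rV[R]_n carries the sup norm in the library; it induces the usual topology,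
   so [open], [continuous], [compact] below have their usual meaning on R^n. *)
Notation borel_rV R n := (g_sigma_algebraType (@open 'rV[R]_n)).

Section borel_rV_measurability.
Context (R : realType).

Lemma measurable_fun_rV d (T : measurableType d) n (f : T -> borel_rV R n) :
  (forall i, measurable_fun setT (fun t => (f t : 'rV[R]_n) 0 i)) ->
  measurable_fun setT f.
Proof.
move=> mf; apply: (@measurability _ _ T (borel_rV R n) setT f (@open 'rV[R]_n)) => //.
move=> _ [A oA <-]; rewrite setTI.
pose q2r (q : 'rV[rat]_n) : 'rV[R]_n := map_mx ratr q.
pose good := [set c : 'rV[rat]_n * nat |
  ball (q2r c.1) c.2.+1%:R^-1 `<=` A].
have -> : f @^-1` A = \bigcup_(c in good) f @^-1` ball (q2r c.1) c.2.+1%:R^-1.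
  apply/seteqP; split => [t /= At|t [c] /= gc]; last exact: gc.
  have /nbhs_ballP[e /= e0 eA] : nbhs (f t : 'rV[R]_n) A.
    by apply: open_nbhs_nbhs; split.
  have [k ke] : exists k : nat, k.+1%:R^-1 < e / 2 :> R.
    have e20 : 0 < e / 2 by rewrite divr_gt0.
    near \oo => k; exists k; near: k.
    exact: (near_infty_natSinv_lt (PosNum e20)).
  have k0 : 0 < k.+1%:R^-1 :> R by rewrite invr_gt0.
  have qP i : exists q : rat, `|(f t : 'rV[R]_n) 0 i - ratr q| < k.+1%:R^-1.
    have /rat_in_itvoo[q] : (f t : 'rV[R]_n) 0 i - k.+1%:R^-1 <
        (f t : 'rV[R]_n) 0 i + k.+1%:R^-1.
      by rewrite ltrD2l gtrN.
    by rewrite in_itv/= => ?; exists q; rewrite distrC ltr_distl.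
  have [q qE] := choice qP.
  have bq : ball (q2r (\row_i q i)) k.+1%:R^-1 (f t : 'rV[R]_n).
    by split => // i j; rewrite !ord1 !mxE/= /ball/= distrC.
  exists (\row_i q i, k) => //= y by_; apply: eA.
  rewrite [e]splitr.
  apply: (@ball_triangle _ _ (q2r (\row_i q i))).
    by apply: ball_sym; apply: le_ball bq; exact: ltW.
  by apply: le_ball by_; exact: ltW.
rewrite bigcup_mkcond; apply: countable_bigcupT_measurable => [//|[q k]].
case: ifP => // _ /=.
have -> : f @^-1` ball (q2r q) k.+1%:R^-1 =
    \bigcap_(i in [set: 'I_n])
      (fun t => (f t : 'rV[R]_n) 0 i) @^-1` ball (ratr (q 0 i) : R) k.+1%:R^-1.
  apply/seteqP; split => t /=.
    by move=> [_ +] i _ => /(_ 0 i); rewrite mxE.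
  move=> H; split => // i j; rewrite ord1 mxE; exact: H.
apply: fin_bigcap_measurable => // i _.
rewrite -[X in measurable X]setTI; apply: mf => //.
exact: measurable_ball.
Unshelve. all: by end_near. Qed.

Lemma measurable_coord n (i : 'I_n) :
  measurable_fun setT (fun x : borel_rV R n => (x : 'rV[R]_n) 0 i).
Proof.
apply: (measurability _ (RGenOpens.measurableE R)).
move=> _ [_ [a [b ->]] <-]; rewrite setTI; apply: sub_sigma_algebra.
by apply: open_comp; [move=> x _; exact: coord_continuous|exact: interval_open].
Qed.

Definition cons_rV n (z : measurableTypeR R * borel_rV R n) : borel_rV R n.+1 :=
  row_mx (z.1%:M : 'rV_1) (z.2 : 'rV[R]_n).

Lemma measurable_cons_rV n : measurable_fun setT (@cons_rV n).
Proof.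
apply: measurable_fun_rV => i.
rewrite /cons_rV; have [j ->|j ->] := @fintype.split_ordP 1 n i.
  rewrite (_ : (fun _ => _) = fst); first exact: measurable_fst.
  apply/funext => z; apply: etrans (row_mxEl _ _ _ _) _.
  by rewrite !ord1 mxE mulr1n.
rewrite (_ : (fun _ => _) = (fun x : borel_rV R n => (x : 'rV[R]_n) 0 j) \o snd).
  by apply: measurableT_comp => //; exact: measurable_coord.
by apply/funext => z; exact: row_mxEr.
Qed.

End borel_rV_measurability.

Section lebesgue_rV_step.
Context (R : realType) (n : nat).
Variable mu : {sigma_finite_measure set (borel_rV R n) -> \bar R}.
Local Open Scope ereal_scope.

Definition lebesgue_rV_step : set (borel_rV R n.+1) -> \bar R :=
  pushforward (@lebesgue_measure R \x mu) (@cons_rV R n).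

Let step0 : lebesgue_rV_step set0 = 0.
Proof. by rewrite /lebesgue_rV_step /pushforward preimage_set0 measure0. Qed.

Let step_ge0 A : 0 <= lebesgue_rV_step A.
Proof. exact: (measure_ge0 (@lebesgue_measure R \x mu)). Qed.

Let step_sigma_additive : semi_sigma_additive lebesgue_rV_step.
Proof.
move=> F mF tF mUF; rewrite /lebesgue_rV_step.
by have := @measurable_cons_rV R n => mc; exact: measure_semi_sigma_additive.
Qed.

HB.instance Definition _ := isMeasure.Build _ _ _ lebesgue_rV_step
  step0 step_ge0 step_sigma_additive.

Let step_sigma_finite : sigma_finite setT lebesgue_rV_step.
Proof.
have /sigma_finiteP[F [FT ndF Foo]] := sigma_finiteT (@lebesgue_measure R).
have /sigma_finiteP[G [GT ndG Goo]] := sigma_finiteT mu.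
pose uncons (x : borel_rV R n.+1) : measurableTypeR R * borel_rV R n :=
  ((x : 'rV[R]_n.+1) ord0 ord0, rsubmx (x : 'rV[R]_(1 + n))).
have consK : cancel (@cons_rV R n) uncons.
  move=> [t v]; rewrite /uncons /cons_rV/= row_mxKr; congr pair.
  rewrite (_ : ord0 = lshift n ord0 :> 'I_(1 + n)); last exact/val_inj.
  by apply: etrans (row_mxEl _ _ _ _) _; rewrite mxE mulr1n.
have muncons : measurable_fun setT uncons.
  apply: measurable_fun_pair; first exact: measurable_coord.
  apply: measurable_fun_rV => i.
  rewrite (_ : (fun _ => _) = fun x : borel_rV R n.+1 =>
    (x : 'rV[R]_n.+1) ord0 (rshift 1 i)); first exact: measurable_coord.
  by apply/funext => x /=; rewrite mxE.
exists (fun k => uncons @^-1` (F k `*` G k)).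
  apply/esym/seteqP; split => // x _.
  have [i _ Fi] : (\bigcup_k F k) (uncons x).1 by rewrite -FT.
  have [j _ Gj] : (\bigcup_k G k) (uncons x).2 by rewrite -GT.
  exists (maxn i j) => //; split.
    by move: Fi; exact/subsetPset/ndF/leq_maxl.
  by move: Gj; exact/subsetPset/ndG/leq_maxr.
move=> k; have [mF Fk] := Foo k; have [mG Gk] := Goo k; split.
  by rewrite -[X in measurable X]setTI; apply: muncons => //; exact: measurableX.
rewrite /lebesgue_rV_step /pushforward -comp_preimage.
rewrite (_ : _ \o _ = id); last by apply/funext => z; exact: consK.
by rewrite preimage_id product_measure1E// lte_mul_pinfty// ge0_fin_numE.
Qed.

HB.instance Definition _ := Measure_isSigmaFinite.Build _ _ _ lebesgue_rV_step
  step_sigma_finite.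

End lebesgue_rV_step.

(* n-dimensional Lebesgue measure on Borel sets, as an iterated product measure;
   [lebesgue_rV_box] is its characteristic property. *)
Fixpoint lebesgue_rV (R : realType) n :
    {sigma_finite_measure set (borel_rV R n) -> \bar R} :=
  match n with
  | 0 => \d_((0 : 'rV[R]_0) : borel_rV R 0)
  | k.+1 => lebesgue_rV_step (lebesgue_rV R k)
  end.

Lemma lebesgue_rV_box (R : realType) n (A : 'I_n -> set (measurableTypeR R)) :
  (forall i, measurable (A i)) ->
  lebesgue_rV R n [set x : 'rV[R]_n | forall i, A i (x ord0 i)] =
  (\prod_(i < n) lebesgue_measure (A i))%E.
Proof.
elim: n A => [|n IHn] A mA.
  rewrite big_ord0 /= diracE mem_set//.
  by case.
rewrite big_ord_recl /= /lebesgue_rV_step /pushforward.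
rewrite -IHn//.
pose B : set (borel_rV R n) :=
  [set x : 'rV[R]_n | forall i, A (lift ord0 i) (x ord0 i)].
have mB : measurable B.
  rewrite (_ : B = \bigcap_(i in [set: 'I_n])
    (fun x : borel_rV R n => (x : 'rV[R]_n) ord0 i) @^-1` A (lift ord0 i)).
    apply: fin_bigcap_measurable => // i _.
    by rewrite -[X in measurable X]setTI; apply: measurable_coord => //; exact: mA.
  by apply/seteqP; split => x /= => [H i _|H i]; exact: H.
rewrite -/B -(product_measure1E _ _ (mA ord0) mB); congr (_ _).
have cons0 t (v : 'rV[R]_n) : cons_rV (t, v) ord0 ord0 = t.
  rewrite (_ : ord0 = lshift n ord0 :> 'I_(1 + n)); last exact/val_inj.
  by apply: etrans (row_mxEl _ _ _ _) _; rewrite mxE mulr1n.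
have consS t (v : 'rV[R]_n) i : cons_rV (t, v) ord0 (lift ord0 i) = v ord0 i.
  rewrite (_ : lift ord0 i = rshift 1 i :> 'I_(1 + n)); last exact/val_inj.
  exact: row_mxEr.
apply/seteqP; split => -[t v] /= => [H|[At Bv] i].
  split; first by have := H ord0; rewrite cons0.
  by move=> i; have := H (lift ord0 i); rewrite consS.
by have [j ->|->] := unliftP ord0 i; [rewrite consS; exact: Bv|rewrite cons0].
Qed.

Section function_spaces.
Context (R : realType) (N : nat).
Implicit Types (u : 'rV[R]_N -> R) (x : 'rV[R]_N).

Definition enorm x : R := Num.sqrt (\sum_i x ord0 i ^+ 2).

Definition partial (i : 'I_N) u : 'rV[R]_N -> R :=
  fun x => 'D_(delta_mx ord0 i) u x.

Definition gradient u x : 'rV[R]_N := \row_i partial i u x.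

Definition smooth u := forall s : seq 'I_N,
  continuous (foldr partial u s) /\
  forall i x, derivable (foldr partial u s) x (delta_mx ord0 i).

Definition compactly_supported u := compact (closure [set x | u x != 0]).

Definition Cc_infty := [set u | smooth u /\ compactly_supported u].

Definition gradient_L1 u : \bar R :=
  (\int[lebesgue_rV R N]_x (enorm (gradient u x))%:E)%E.

(* In the next two definitions the quotient is 0 on the diagonal x = y, since its
   numerator is. *)
Definition difference_quotient (a : R) u (z : borel_rV R N * borel_rV R N) : R :=
  (u z.1 - u z.2) / enorm (z.1 - z.2) `^ a.

Definition gagliardo (sigma q : R) u : \bar R :=
  ((\int[lebesgue_rV R N \x lebesgue_rV R N]_z
     (`|u z.1 - u z.2| `^ q / enorm (z.1 - z.2) `^ (N%:R + sigma * q))%:E)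
   `^ q^-1)%E.

End function_spaces.

Definition marcinkiewicz d (T : measurableType d) (R : realType)
    (mu : set T -> \bar R) (p : R) (f : T -> R) : \bar R :=
  (ereal_sup [set (lambda `^ p)%:E * mu [set z | (lambda <= `|f z|)%R]
             | lambda in [set lambda : R | (0 < lambda)%R]] `^ p^-1)%E.

(* Main.v *)
Require Import Defs.
From HB Require Import structures.
From mathcomp Require Import all_boot all_order all_algebra.
From mathcomp Require Import all_classical all_reals all_analysis.
From mathcomp Require Import measurable_realfun ring lra zify.

Set Implicit Arguments.
Unset Strict Implicit.
Unset Printing Implicit Defensive.

Import Order.TTheory GRing.Theory Num.Theory.
Import numFieldNormedType.Exports.

Local Open Scope classical_set_scope.
Local Open Scope ring_scope.

(* Write the quotient as f = f1^theta f2^(1-theta), where f1 and f2 have exponents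
   N/p1 + s1 and N + 1. Chebyshev bounds f1 in M^p1 by the Gagliardo semi-norm, and
   splitting {|f| >= lam} into {|f1| >= al} and {|f2| >= be}, with al and be chosen
   to balance the two bounds, reduces the claim to the weak-type estimate
     L^2N {(x, x + h) : |u(x + h) - u(x)| >= lam |h|^(N+1)} <= C(N) / lam |grad u|_1.
   For the latter, group h by dyadic scales, h = 2^j e with r <= |e| < 2 r. For fixed e,
   average over the translates x + m e: what remains is a statement on the sequence
   v_i = |u(x + (i+1) e) - u(x + i e)|, that windows of length 2^j and mass at least
   nu 2^(j(N+1)), counted with weight 2^(jN), total at most 8/nu times the mass of v.
   It follows from a stopping-time argument on the dyadic tree, replacing Vitali's
   covering lemma. Finally the L^1 norm of u(. + e) - u is at most N |e| |grad u|_1. *)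

(** * Combinatorics of heavy dyadic blocks of a nonnegative sequence *)

Section dyadic_blocks.
Context (R : realFieldType) (d : nat).
Implicit Types (v : nat -> R) (nu : R) (j q L M m : nat).

Definition block v j q : R := \sum_(q * 2 ^ j <= i < q.+1 * 2 ^ j) v i.

(** The weight [2 ^+ (j * d.+1)] is the weight [2 ^+ (j * d)] of one window times the [2 ^ j]
    windows that start in a block of level [j]. *)
Definition block_weight v nu j q : R :=
  if nu * 2 ^+ (j * d.+1) <= block v j q then 2 ^+ (j * d.+1) else 0.

(** Total weight of block [q] of level [L] and of all its dyadic descendants. The recursion on
    levels is the one that the stopping-time induction follows. *)
Fixpoint tree_weight v nu L q : R :=
  block_weight v nu L q +
  (if L is L'.+1 then tree_weight v nu L' q.*2 + tree_weight v nu L' q.*2.+1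
   else 0).

Lemma block_split v j q :
  block v j.+1 q = block v j q.*2 + block v j q.*2.+1.
Proof.
rewrite /block (@big_cat_nat _ _ _ (q.*2.+1 * 2 ^ j)) /=.
- by rewrite expnS -!muln2; congr (_ + _); apply: congr_big_nat => //; nia.
- by rewrite expnS -!muln2; nia.
- by rewrite expnS -!muln2; nia.
Qed.

Lemma block_weight_ge0 v nu j q : 0 <= block_weight v nu j q.
Proof. by rewrite /block_weight; case: ifP => // _; rewrite exprn_ge0. Qed.

Lemma block_weight_le v nu j q : block_weight v nu j q <= 2 ^+ (j * d.+1).
Proof. by rewrite /block_weight; case: ifP => // _; rewrite exprn_ge0. Qed.

(** Going down one level doubles the number of blocks and divides the weight of each by [2 ^+ d.+1],
    so the levels form a geometric series of ratio at most 1/2. This is where [0 < d] enters,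
    through [4 <= 2 ^+ d.+1]. *)
Lemma tree_weight_le_size v nu L q : (0 < d)%N ->
  tree_weight v nu L q <= 2 * 2 ^+ (L * d.+1).
Proof.
move=> d0; elim: L q => [|L IH] q /=.
  by have := block_weight_le v nu 0 q; rewrite mul0n expr0; lra.
have := block_weight_le v nu L.+1 q; have := IH q.*2; have := IH q.*2.+1.
rewrite mulSn exprD.
have : 4 * 2 ^+ (L * d.+1) <= 2 ^+ d.+1 * 2 ^+ (L * d.+1) :> R.
  rewrite ler_wpM2r ?exprn_ge0//.
  by rewrite (_ : 4 = 2 ^+ 2) ?ler_weXn2l ?ler1n//; ring.
lra.
Qed.

(* A heavy block is charged the crude size bound; a light one passes the
   estimate on from its two halves. *)
Lemma tree_weight_le_mass v nu L q : (0 < d)%N -> 0 <= nu -> (forall i, 0 <= v i) ->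
  nu * tree_weight v nu L q <= 2 * block v L q.
Proof.
move=> d0 nu0 v0; elim: L q => [|L IH] q /=.
  rewrite addr0 /block_weight; case: ifP => [|_].
    have : 0 <= block v 0 q by rewrite sumr_ge0.
    lra.
  by rewrite mulr0 mulr_ge0// sumr_ge0.
rewrite {1}/block_weight; case: ifP => [heavy|_].
  have := tree_weight_le_size v nu L.+1 q d0; rewrite /= /block_weight heavy.
  by move=> /(ler_wpM2l nu0); lra.
by have := IH q.*2; have := IH q.*2.+1; rewrite block_split; lra.
Qed.

(** Regroups the weights by level: the children of [M] adjacent roots are [M * 2] adjacent roots one
    level below, to which the induction hypothesis applies. *)
Lemma sum_tree_weight v nu L M :
  \sum_(0 <= q < M) tree_weight v nu L q =
  \sum_(0 <= j < L.+1) \sum_(0 <= q < M * 2 ^ (L - j)) block_weight v nu j q.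
Proof.
elim: L M => [|L IH] M.
  rewrite big_nat1 muln1; apply: eq_bigr => q _ /=; exact: addr0.
rewrite big_nat_recr//= subnn muln1 big_split/= addrC; congr (_ + _).
have -> : \sum_(0 <= q < M)
    (tree_weight v nu L q.*2 + tree_weight v nu L q.*2.+1) =
    \sum_(0 <= q < M * 2) tree_weight v nu L q.
  rewrite big_nat_mul; apply: eq_bigr => q _.
  rewrite (_ : q.+1 * 2 = (q * 2).+2)%N; last by lia.
  by rewrite big_nat_recr ?leqW// big_nat1 muln2.
rewrite IH; apply: eq_big_nat => j /andP[_ jL].
by rewrite subSn// expnS mulnA.
Qed.

(** A window of length [2 ^ j] meets only the block where it starts and the next one. *)
Lemma window_le_blocks v j m : (forall i, 0 <= v i) ->
  \sum_(m <= i < m + 2 ^ j) v i <= block v j (m %/ 2 ^ j) + block v j (m %/ 2 ^ j).+1.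
Proof.
move=> v0; rewrite /block -big_cat_nat/=; [|exact: leq_mul|exact: leq_mul].
have j0 : (0 < 2 ^ j)%N by rewrite expn_gt0.
have m1 : (m %/ 2 ^ j * 2 ^ j <= m)%N by exact: leq_trunc_div.
have m2 : (m < (m %/ 2 ^ j).+1 * 2 ^ j)%N by rewrite -ltn_divLR.
rewrite (@big_cat_nat _ _ _ m (m %/ 2 ^ j * 2 ^ j)%N ((m %/ 2 ^ j).+2 * 2 ^ j)%N)//=; last by nia.
rewrite (@big_cat_nat _ _ _ (m + 2 ^ j) m ((m %/ 2 ^ j).+2 * 2 ^ j)%N)//=; last first.
- by move: m2; lia.
- exact: leq_addr.
rewrite addrCA ler_wpDr// addr_ge0// sumr_ge0//.
Qed.

(** One of the two blocks covering a heavy window carries half of its mass, hence is heavy for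
    [nu / 2]. The constant 8 is the product of three factors 2: the halved threshold, the tree
    estimate, and the fact that a block is charged both by windows starting in it and by windows
    starting in its predecessor. *)
Lemma window_sum_le v nu J : (0 < d)%N -> 0 < nu -> (forall i, 0 <= v i) ->
  \sum_(0 <= j < J) \sum_(0 <= m < 2 ^ J)
    (if nu * 2 ^+ (j * d.+1) <= \sum_(m <= i < m + 2 ^ j) v i
     then 2 ^+ (j * d) else 0) <=
  8 / nu * \sum_(0 <= i < 2 ^ J.+1) v i.
Proof.
move=> d0 nu0 v0.
have hnu0 : 0 < nu / 2 by lra.
(* The root has length [2 ^ J.+1], twice the range of starting points, so that the block after the
   one where a window starts is still in the tree. *)
have := tree_weight_le_mass J.+1 0 d0 (ltW hnu0) v0.
have := sum_tree_weight v (nu / 2) J.+1 1; rewrite big_nat1 => ->.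
rewrite /block mul0n mul1n => massE.
rewrite mulrAC ler_pdivlMr//.
suff : \sum_(0 <= j < J) \sum_(0 <= m < 2 ^ J)
    (if nu * 2 ^+ (j * d.+1) <= \sum_(m <= i < m + 2 ^ j) v i
     then 2 ^+ (j * d) else 0) <=
    2 * \sum_(0 <= j < J.+2) \sum_(0 <= q < 1 * 2 ^ (J.+1 - j)) block_weight v (nu / 2) j q.
  move=> H; have {}H := ler_wpM2r (ltW nu0) H; lra.
rewrite (@big_cat_nat _ _ _ J 0 J.+2)//=; last by lia.
rewrite mulrDr ler_wpDr//.
  by rewrite mulr_ge0// sumr_ge0// => j _; rewrite sumr_ge0// => q _; exact: block_weight_ge0.
rewrite mulr_sumr; apply: ler_sum_nat => j /andP[_ jJ].
rewrite mul1n.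
have -> : (2 ^ J = 2 ^ (J - j) * 2 ^ j)%N by rewrite -expnD subnK// ltnW.
rewrite big_nat_mul.
apply: (@le_trans _ _ (\sum_(0 <= q < 2 ^ (J - j))
   (block_weight v (nu / 2) j q + block_weight v (nu / 2) j q.+1))).
  apply: ler_sum_nat => q _.
  (* Each of the [2 ^ j] starting points in block [q] is charged an equal share of the weights of
     blocks [q] and [q.+1]. *)
  apply: (@le_trans _ _ (\sum_(q * 2 ^ j <= m < q.+1 * 2 ^ j)
    (block_weight v (nu / 2) j q + block_weight v (nu / 2) j q.+1) / 2 ^+ j)).
    apply: ler_sum_nat => m /andP[qm mq].
    have mE : (m %/ 2 ^ j = q)%N.
      apply/eqP; rewrite eqn_leq -ltnS ltn_divLR ?expn_gt0// mq/=.
      by rewrite leq_divRL ?expn_gt0.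
    have pj : 0 < 2 ^+ j :> R by rewrite exprn_gt0.
    case: ifP => [le|_]; last by rewrite divr_ge0 ?exprn_ge0// addr_ge0 ?block_weight_ge0.
    have := le_trans le (window_le_blocks j m v0); rewrite mE => {}le.
    rewrite ler_pdivlMr// -exprD addnC -mulnS.
    rewrite /block_weight.
    case: ifP => [_|/negbT]; first by rewrite ler_wpDr//; case: ifP => // _; rewrite exprn_ge0.
    rewrite -ltNge => h1; case: ifP => [_|/negbT]; first by rewrite add0r.
    rewrite -ltNge => h2; lra.
  rewrite sumr_const_nat mulSn addnK -[leLHS]mulr_natr natrX divfK//.
(* The successors [q.+1] run from 1 to [2 ^ (J - j)] inclusive, which still are indices of blocks of
   the tree. *)
have jlt : (2 ^ (J - j) < 2 ^ (J.+1 - j))%N by rewrite ltn_exp2l// subSn// ltnW.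
have weightS : \sum_(0 <= q < 2 ^ (J - j)) block_weight v (nu / 2) j q.+1 =
    \sum_(1 <= q < (2 ^ (J - j)).+1) block_weight v (nu / 2) j q by rewrite big_add1.
rewrite big_split/= weightS mulr_natl mulr2n lerD//.
  rewrite [leRHS](@big_cat_nat _ _ _ (2 ^ (J - j)))//=; last exact: ltnW.
  by rewrite ler_wpDr// sumr_ge0// => q _; exact: block_weight_ge0.
rewrite [leRHS](@big_cat_nat _ _ _ 1)//=; last by rewrite expn_gt0.
rewrite [X in _ <= _ + X](@big_cat_nat _ _ _ (2 ^ (J - j)).+1)//=.
by rewrite addrCA ler_wpDr// addr_ge0// sumr_ge0// => q _; exact: block_weight_ge0.
Qed.

End dyadic_blocks.

(** * Indicators of boolean predicates and their integrals *)

Section boolean_indicators.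
Context (R : realType).

Lemma ge0_sume_const_nat n (a : \bar R) : (0 <= a)%E ->
  (\sum_(0 <= i < n) a = n%:R%:E * a)%E.
Proof.
move=> a0; elim: n => [|n IH]; first by rewrite big_geq// mul0e.
by rewrite big_nat_recr//= IH -natr1 EFinD ge0_muleDl ?lee_fin// mul1e.
Qed.

Lemma measurable_fun_bool_natr d (T : measurableType d) (b : T -> bool) :
  measurable_fun setT b -> measurable_fun setT (fun t => (b t)%:R%:E : \bar R).
Proof.
move=> mb; apply/measurable_EFinP.
rewrite (_ : (fun _ => _) = fun t => if b t then 1 else 0).
  exact: measurable_fun_ifT.
by apply/funext => t; case: (b t).
Qed.

Lemma measurable_set_bool d (T : measurableType d) (b : T -> bool) :
  measurable_fun setT b -> measurable [set t | b t].
Proof. by move=> mb; rewrite -[X in measurable X]setTI; exact: (mb measurableT [set true]). Qed.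

Lemma integral_set_bool d (T : measurableType d) (m : {measure set T -> \bar R})
    (b : T -> bool) : measurable_fun setT b ->
  (\int[m]_t (b t)%:R%:E)%E = m [set t | b t].
Proof.
move=> mb; rewrite -[X in _ = m X]setIT -integral_indic//; last exact: measurable_set_bool.
apply: eq_integral => t _; rewrite indicE; congr (_%:R%:E).
by case: (boolP (b t)) => bt; [rewrite mem_set|rewrite memNset//; exact/negP].
Qed.

End boolean_indicators.

(** * Lebesgue measure under dilations and translations *)

Section affine_change_of_variables.
Context (R : realType).
Local Open Scope ereal_scope.

Lemma measurable_affine1 (c a : R) :
  measurable_fun setT ((fun t => c * t + a)%R : measurableTypeR R -> measurableTypeR R).
Proof. by apply: measurable_funD => //; exact: measurable_funM. Qed.

(** The pushforward of Lebesgue measure by the affine map, multiplied by [c], gives half-open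
    intervals their length, hence is Lebesgue measure by uniqueness. *)
Lemma ge0_integral_affine1 (c a : R) (f : measurableTypeR R -> \bar R) : (0 < c)%R ->
  measurable_fun setT f -> (forall t, 0 <= f t) ->
  c%:E * \int[@lebesgue_measure R]_t f (c * t + a)%R = \int[@lebesgue_measure R]_t f t.
Proof.
move=> c0 mf f0.
have mA := measurable_affine1 c a.
rewrite [RHS](eq_measure_integral (mscale (NngNum (ltW c0))
    (pushforward (@lebesgue_measure R)
      ((fun t => c * t + a)%R : measurableTypeR R -> measurableTypeR R)))); last first.
  move=> A mA' _; apply: lebesgue_measure_unique => // _ [[x y]] _ <-/=.
  rewrite /mscale/= /pushforward.
  rewrite (_ : _ @^-1` _ = `](x - a) / c, (y - a) / c]%classic)%R; last first.
    apply/seteqP; split => t /=; rewrite !in_itv/= ltr_pdivrMr// ler_pdivlMr//;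
      by rewrite ltrBlDr lerBrDr mulrC.
  rewrite !lebesgue_measure_itv/= !lte_fin ltr_pM2r ?invr_gt0// ltrD2r.
  case: ifPn => [xy|]; last by rewrite mule0.
  by rewrite -!EFinD -EFinM; congr EFin; field; exact: lt0r_neq0.
by rewrite ge0_integral_mscale// ge0_integral_pushforward.
Qed.

Lemma measurable_affine n (c : R) (v : 'rV[R]_n) :
  measurable_fun setT ((fun x => c *: x + v)%R : borel_rV R n -> borel_rV R n).
Proof.
apply: measurable_fun_rV => i.
under eq_fun do rewrite !mxE.
by apply: measurable_funD => //; apply: measurable_funM => //; exact: measurable_coord.
Qed.

Lemma measurable_translation n (v : 'rV[R]_n) :
  measurable_fun setT ((fun x => x + v)%R : borel_rV R n -> borel_rV R n).
Proof.
by have := measurable_affine 1 v; apply: eq_measurable_fun => x _; rewrite scale1r.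
Qed.

Lemma ge0_integral_rVS n (f : borel_rV R n.+1 -> \bar R) :
  measurable_fun setT f -> (forall x, 0 <= f x) ->
  \int[lebesgue_rV R n.+1]_x f x =
  \int[@lebesgue_measure R]_t \int[lebesgue_rV R n]_y f (cons_rV (t, y)).
Proof.
move=> mf f0; rewrite /= ge0_integral_pushforward//; last exact: measurable_cons_rV.
rewrite fubini_tonelli1// => [|z]; last exact: f0.
by apply: (measurableT_comp mf); exact: measurable_cons_rV.
Qed.

(** Induction on the dimension: Tonelli splits off the first coordinate, the one-dimensional case
    handles the outer integral and the induction hypothesis the inner one. *)
Lemma ge0_integral_affine n (c : R) (v : 'rV[R]_n) (f : borel_rV R n -> \bar R) :
  (0 < c)%R -> measurable_fun setT f -> (forall x, 0 <= f x) ->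
  (c ^+ n)%:E * \int[lebesgue_rV R n]_x f (c *: (x : 'rV[R]_n) + v)%R =
  \int[lebesgue_rV R n]_x f x.
Proof.
elim: n v f => [|n IH] v f c0 mf f0.
  rewrite expr0 mul1e; apply: eq_integral => x _; congr f.
  by apply/rowP => -[].
have mfa : measurable_fun setT (fun x : borel_rV R n.+1 => f (c *: (x : 'rV[R]_n.+1) + v)%R).
  by apply: (measurableT_comp mf); exact: measurable_affine.
have mfc : measurable_fun setT (f \o @cons_rV R n).
  by apply: (measurableT_comp mf); exact: measurable_cons_rV.
rewrite !ge0_integral_rVS//.
pose F t := \int[lebesgue_rV R n]_y f (cons_rV (t, y)).
have mF : measurable_fun setT F := measurable_fun_fubini_tonelli_F _ mfc (fun _ => f0 _).
have F0 t : 0 <= F t by exact: integral_ge0.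
pose v0 : R := v ord0 ord0; pose v' : 'rV[R]_n := \row_i v ord0 (lift ord0 i).
have cons_affine t y :
    (c *: (cons_rV (t, y) : 'rV[R]_n.+1) + v = cons_rV (c * t + v0, c *: y + v'))%R.
  apply/rowP => i; rewrite /cons_rV !mxE.
  have [k ->|k ->] := @fintype.split_ordP 1 n i.
    by rewrite ord1 !mxE/= !mulr1n; congr (_ + v _ _)%R; exact: val_inj.
  by rewrite !mxE; congr (_ + v _ _)%R; exact: val_inj.
under eq_integral do under eq_integral do rewrite cons_affine.
apply: etrans _ (ge0_integral_affine1 v0 c0 mF F0).
rewrite exprS EFinM -muleA; congr (_ * _).
rewrite -ge0_integralZl//.
- apply: eq_integral => t _; apply: IH => //.
  by apply: (measurableT_comp mfc); exact: measurable_fun_pair.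
- apply: (@measurable_fun_fubini_tonelli_F _ _ _ _ _ (lebesgue_rV R n)
    (fun z => f (cons_rV (c * z.1 + v0, c *: (z.2 : 'rV[R]_n) + v')%R))) => //.
  under eq_fun do rewrite -cons_affine.
  by apply: (measurableT_comp mfa); exact: measurable_cons_rV.
- by move=> t _; exact: integral_ge0.
- by rewrite lee_fin exprn_ge0// ltW.
Qed.

Lemma ge0_integral_translation n (v : 'rV[R]_n) (f : borel_rV R n -> \bar R) :
  measurable_fun setT f -> (forall x, 0 <= f x) ->
  \int[lebesgue_rV R n]_x f ((x : 'rV[R]_n) + v)%R = \int[lebesgue_rV R n]_x f x.
Proof.
move=> mf f0; rewrite -[RHS](ge0_integral_affine v ltr01)// expr1n mul1e.
by apply: eq_integral => x _; rewrite scale1r.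
Qed.

End affine_change_of_variables.

(** * The Euclidean norm, measurability, and the volume of annuli *)

Section euclidean_space.
Context (R : realType) (N : nat).
Implicit Types (u : 'rV[R]_N -> R) (x h : 'rV[R]_N).

Lemma continuous_measurable_rV u : continuous u ->
  measurable_fun setT (u : borel_rV R N -> measurableTypeR R).
Proof.
move=> cu; apply: (measurability _ (RGenOpens.measurableE R)).
move=> _ [_ [a [b ->]] <-]; rewrite setTI; apply: sub_sigma_algebra.
by apply: open_comp; [move=> x _; exact: cu|exact: interval_open].
Qed.

Lemma measurable_addrV d (T : measurableType d) (f g : T -> borel_rV R N) :
  measurable_fun setT f -> measurable_fun setT g ->
  measurable_fun setT (fun t => (f t : 'rV[R]_N) + (g t : 'rV[R]_N) : borel_rV R N).
Proof.
move=> mf mg; apply: measurable_fun_rV => i; under eq_fun do rewrite mxE.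
by apply: measurable_funD; exact: (measurableT_comp (measurable_coord i)).
Qed.

Lemma enorm_ge0 x : 0 <= enorm x.
Proof. exact: sqrtr_ge0. Qed.

Lemma normr_coord_le_enorm x i : `|x ord0 i| <= enorm x.
Proof.
rewrite /enorm -sqrtr_sqr ler_wsqrtr// (bigD1 i)//= lerDl sumr_ge0// => j _.
exact: sqr_ge0.
Qed.

Lemma enormZ (c : R) x : 0 <= c -> enorm (c *: x) = c * enorm x.
Proof.
move=> c0; rewrite /enorm.
under eq_bigr do rewrite mxE exprMn.
by rewrite -mulr_sumr sqrtrM ?sqr_ge0// sqrtr_sqr ger0_norm.
Qed.

Lemma enormN x : enorm (- x) = enorm x.
Proof. by rewrite /enorm; under eq_bigr do rewrite mxE sqrrN. Qed.

Lemma measurable_enorm :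
  measurable_fun setT (@enorm R N : borel_rV R N -> measurableTypeR R).
Proof.
apply: (@measurableT_comp _ _ _ _ _ _ (@Num.sqrt R)) => //.
  exact: (continuous_measurable_fun (@sqrt_continuous R)).
apply: (@measurable_sum _ _ _ _ _ _ (fun i (x : borel_rV R N) => (x : 'rV[R]_N) ord0 i ^+ 2)).
by move=> i; apply: measurable_funX; exact: measurable_coord.
Qed.

Lemma measurable_enorm_itv (a b : R) :
  measurable_fun setT (fun h : borel_rV R N => a <= enorm (h : 'rV[R]_N) < b).
Proof.
by apply: measurable_and; [apply: measurable_fun_ler|apply: measurable_fun_ltr] => //;
  exact: measurable_enorm.
Qed.

(** The annulus lies in the cube [[-2r, 2r]^N], whose side is [4 * r]. *)
Lemma annulus_volume_le (r : R) : 0 < r ->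
  (\int[lebesgue_rV R N]_h (r <= enorm (h : 'rV[R]_N) < 2 * r)%R%:R%:E <= ((4 * r) ^+ N)%:E)%E.
Proof.
move=> r0; rewrite integral_set_bool; last exact: measurable_enorm_itv.
pose A (i : 'I_N) : set (measurableTypeR R) := `[- (2 * r), 2 * r]%classic.
apply: (@le_trans _ _ (lebesgue_rV R N [set x : 'rV[R]_N | forall i, A i (x ord0 i)])).
  apply: le_measure; rewrite ?inE.
  - by apply: measurable_set_bool; exact: measurable_enorm_itv.
  - rewrite (_ : [set _ | _] = \bigcap_(i in [set: 'I_N])
      (fun x : borel_rV R N => (x : 'rV[R]_N) ord0 i) @^-1` A i).
      apply: fin_bigcap_measurable => // i _.
      by rewrite -[X in measurable X]setTI; apply: measurable_coord => //; exact: measurable_itv.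
    by apply/seteqP; split => x /= => [H i _|H i]; exact: H.
  - move=> h /= /andP[_ h2] i; rewrite /A/= in_itv/= -ler_norml.
    exact: le_trans (normr_coord_le_enorm _ _) (ltW h2).
rewrite lebesgue_rV_box; last by move=> i; exact: measurable_itv.
under eq_bigr do rewrite lebesgue_measure_itv/=.
rewrite lte_fin gtrN ?mulr_gt0// -EFinB opprK.
rewrite (eq_bigr (fun=> (4 * r)%:E)); last by move=> i _; congr EFin; ring.
by rewrite prodEFin prodr_const card_ord.
Qed.

End euclidean_space.

(** * Increments in L^1 bounded by the gradient *)

Section increments.
Context (R : realType) (N : nat).
Implicit Types (u : 'rV[R]_N -> R) (x h : 'rV[R]_N).

Lemma is_derive_line u x v t : derivable u (x + t *: v) v ->
  is_derive t (1 : R) (fun t => u (x + t *: v)) ('D_v u (x + t *: v)).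
Proof.
move=> du.
have E : (fun h : R => h^-1 *: (((fun t => u (x + t *: v)) \o shift t) (h *: 1) -
    u (x + t *: v))) = (fun h : R => h^-1 *: ((u \o shift (x + t *: v)) (h *: v) -
    u (x + t *: v))).
  apply/funext => h /=; congr (_ *: (u _ - _)).
  by rewrite scalerDl [h *: 1]mulr1 addrCA.
by split; rewrite /derivable /derive E.
Qed.

(** Fundamental theorem of calculus along the segment, followed by the triangle inequality for
    integrals. *)
Lemma increment_le u i x (a : R) : continuous u ->
  (forall x, derivable u x (delta_mx ord0 i)) -> continuous (partial i u) ->
  0 < a ->
  (`|u (x + a *: delta_mx ord0 i) - u x|%:E <=
   \int[@lebesgue_measure R]_(t in `[0%R, a])
      `|partial i u (x + t *: delta_mx ord0 i)|%:E)%E.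
Proof.
move=> cu du cp a0; set e := delta_mx _ _.
have line_cont : continuous (fun t : R => x + t *: e).
  by move=> t; apply: cvgD; [exact: cvg_cst|apply: cvgZl; exact: cvg_id].
have cpl : continuous (fun t : R => partial i u (x + t *: e)).
  by move=> t; apply: continuous_comp; [exact: line_cont|exact: cp].
have cul : continuous (fun t : R => u (x + t *: e)).
  by move=> t; apply: continuous_comp; [exact: line_cont|exact: cu].
have Dl t := is_derive_line (du (x + t *: e)).
have := @continuous_FTC2 R (fun t => partial i u (x + t *: e))
  (fun t => u (x + t *: e)) 0 a a0.
rewrite scale0r addr0 -EFinB => FTC.
rewrite -abse_EFin -FTC.
- apply: le_trans (le_abse_integral _ _ _) _ => //=.
  by apply/measurable_EFinP; apply: measurable_funTS; exact: continuous_measurable_fun.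
- exact: continuous_subspaceT.
- split.
  + by move=> t _; have [] := Dl t.
  + by apply: cvg_at_right_filter; apply: cul.
  + by apply: cvg_at_left_filter; apply: cul.
- by move=> t _; rewrite derive1E; have [_ ->] := Dl t.
Qed.

(** After integrating the segment bound in [x] and exchanging integrals, every [t] in [[0, a]]
    contributes the same amount by translation invariance. A negative [a] is reduced to [- a] by
    translating [x]. *)
Lemma integral_coord_increment_le u i (a : R) : continuous u ->
  (forall x, derivable u x (delta_mx ord0 i)) -> continuous (partial i u) ->
  (\int[lebesgue_rV R N]_x
      `|u ((x : 'rV[R]_N) + a *: delta_mx ord0 i) - u x|%:E <=
   `|a|%:E * \int[lebesgue_rV R N]_x `|partial i u x|%:E)%E.
Proof.
move=> cu du cp.
set e : 'rV[R]_N := delta_mx _ _.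
have mincr b : measurable_fun setT
    (fun x : borel_rV R N => `|u ((x : 'rV[R]_N) + b *: e) - u x|%:E).
  apply/measurable_EFinP; apply: (measurableT_comp (@normr_measurable _ _)).
  apply: measurable_funB; last exact: continuous_measurable_rV.
  by apply: (measurableT_comp (continuous_measurable_rV cu)); exact: measurable_translation.
have pos b : 0 < b ->
  (\int[lebesgue_rV R N]_x `|u ((x : 'rV[R]_N) + b *: e) - u x|%:E <=
   b%:E * \int[lebesgue_rV R N]_x `|partial i u x|%:E)%E.
  move=> b0.
  have mp : measurable_fun setT (fun x : borel_rV R N => `|partial i u x|%:E).
    apply/measurable_EFinP; apply: (measurableT_comp (@normr_measurable _ _)).
    exact: continuous_measurable_rV.
  pose f (z : measurableTypeR R * borel_rV R N) : \bar R :=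
    ((\1_`[0%R, b]%classic z.1 : R)%:E * `|partial i u ((z.2 : 'rV[R]_N) + z.1 *: e)|%:E)%E.
  have m1 : measurable_fun setT (\1_`[0%R, b]%classic : measurableTypeR R -> R).
    exact: measurable_indic.
  have mf : measurable_fun setT f.
    apply: emeasurable_funM.
      by apply/measurable_EFinP; apply: (measurableT_comp m1).
    apply: (measurableT_comp mp) => /=.
    apply: measurable_fun_rV => k; under eq_fun do rewrite !mxE.
    apply: measurable_funD; last exact: measurable_funM.
    by apply: (measurableT_comp (measurable_coord k)); exact: measurable_snd.
  have f0 z : (0 <= f z)%E by rewrite mule_ge0// lee_fin.
  apply: (@le_trans _ _ (\int[lebesgue_rV R N]_x \int[@lebesgue_measure R]_t f (t, x))%E).
    apply: ge0_le_integral => //.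
    - exact: measurable_fun_fubini_tonelli_G.
    - move=> x _; apply: le_trans; first exact: (increment_le x cu du cp b0).
      rewrite integral_mkcond; under [leRHS]eq_integral do rewrite /f/=.
      rewrite le_eqVlt; apply/orP; left; apply/eqP/eq_integral => t _.
      by rewrite epatch_indic/= muleC.
  rewrite -fubini_tonelli//.
  set I := (\int[lebesgue_rV R N]_x _)%E.
  have inner t : (\int[lebesgue_rV R N]_x f (t, x) = I * (\1_`[0%R, b]%classic t : R)%:E)%E.
    rewrite /f/= ge0_integralZl//.
      by rewrite (ge0_integral_translation (t *: e) (f := fun x => `|partial i u x|%:E))// muleC.
    by apply: (measurableT_comp mp); exact: measurable_translation.
  under eq_integral do rewrite inner.
  rewrite ge0_integralZl//; last 2 first.
  - exact/measurable_EFinP.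
  - exact: integral_ge0.
  rewrite integral_indic// setIT muleC lee_pmul//; first exact: integral_ge0.
  by rewrite [leLHS]lebesgue_measure_itv/= lte_fin b0 oppr0 adde0.
have [a0|a0|<-] := ltgtP 0 a.
- by rewrite gtr0_norm//; exact: pos.
- rewrite ltr0_norm//; apply: le_trans (pos (- a) _); last by rewrite oppr_gt0.
  rewrite -(ge0_integral_translation (- a *: e))//.
  rewrite le_eqVlt; apply/orP; left; apply/eqP/eq_integral => x _.
  by rewrite distrC -addrA -scalerDl addNr scale0r addr0.
- rewrite normr0 mul0e; under eq_integral do rewrite scale0r addr0 subrr normr0.
  by rewrite integral0.
Qed.

(** Going from [x] to [x + h] one coordinate at a time takes [N] moves, each of length at most
    [enorm h]; translation invariance makes the starting point of each move irrelevant. *)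
Lemma integral_increment_le u h : continuous u ->
  (forall i x, derivable u x (delta_mx ord0 i)) -> (forall i, continuous (partial i u)) ->
  (\int[lebesgue_rV R N]_x `|u ((x : 'rV[R]_N) + h) - u x|%:E <=
   (N%:R * enorm h)%:E * gradient_L1 u)%E.
Proof.
move=> cu du cp.
have mincr g w : measurable_fun setT
    (fun x : borel_rV R N => `|u ((x : 'rV[R]_N) + g) - u ((x : 'rV[R]_N) + w)|%:E).
  apply/measurable_EFinP; apply: (measurableT_comp (@normr_measurable _ _)).
  by apply: measurable_funB; apply: (measurableT_comp (continuous_measurable_rV cu));
    exact: measurable_translation.
have mincr0 g : measurable_fun setT
    (fun x : borel_rV R N => `|u ((x : 'rV[R]_N) + g) - u x|%:E).
  by have := mincr g 0; apply: eq_measurable_fun => x _; rewrite addr0.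
have mgrad : measurable_fun setT (fun x : borel_rV R N => (enorm (gradient u x))%:E).
  apply/measurable_EFinP; apply: (measurableT_comp (@measurable_enorm R N)).
  apply: measurable_fun_rV => i; under eq_fun do rewrite mxE.
  exact: continuous_measurable_rV.
have coord i : (\int[lebesgue_rV R N]_x
    `|u ((x : 'rV[R]_N) + h ord0 i *: delta_mx ord0 i) - u x|%:E <=
    (enorm h)%:E * gradient_L1 u)%E.
  apply: le_trans (integral_coord_increment_le _ cu (du i) (cp i)) _.
  apply: lee_pmul => //; first exact: integral_ge0.
    by rewrite lee_fin normr_coord_le_enorm.
  apply: ge0_le_integral => //.
    apply/measurable_EFinP; apply: (measurableT_comp (@normr_measurable _ _)).
    exact: continuous_measurable_rV.
  move=> x _; rewrite lee_fin.
  by have := normr_coord_le_enorm (gradient u x) i; rewrite mxE.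
(* Stated for an arbitrary list of coordinates, so that the moves can be added by induction on the
   list. *)
suff telescope (s : seq 'I_N) : (\int[lebesgue_rV R N]_x
    `|u ((x : 'rV[R]_N) + \sum_(i <- s) h ord0 i *: delta_mx ord0 i) - u x|%:E <=
    (size s)%:R%:E * ((enorm h)%:E * gradient_L1 u))%E.
  have := telescope (index_enum 'I_N); rewrite -row_sum_delta EFinM muleA.
  by rewrite -[index_enum _]enumT size_enum_ord.
elim: s => [|i s IH].
  rewrite mul0e; under eq_integral do rewrite big_nil addr0 subrr normr0.
  by rewrite integral0.
rewrite big_cons; set g := h ord0 i *: _; set w := \sum_(_ <- s) _.
rewrite -natr1 EFinD ge0_muleDl// ?lee_fin// mul1e.
apply: le_trans (leeD IH (coord i)).
rewrite -(ge0_integral_translation g (f := fun x => `|u ((x : 'rV[R]_N) + w) - u x|%:E))//.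
rewrite -ge0_integralD//; last first.
  by under eq_fun do rewrite -addrA; exact: mincr.
apply: ge0_le_integral => //.
  by apply: emeasurable_funD => //; under eq_fun do rewrite -addrA; exact: mincr.
move=> x _; rewrite -EFinD lee_fin addrA.
by apply: le_trans (ler_normD _ _); rewrite addrA subrK.
Qed.

End increments.

(** * The weak-type estimate at the gradient endpoint *)

Section weak_type_estimate.
Context (R : realType) (N : nat).
Implicit Types (u : 'rV[R]_N -> R) (x h e : 'rV[R]_N).
Local Notation mu := (lebesgue_rV R N).

(** The superlevel condition on the quotient with denominator [enorm h ^+ N.+1], multiplied out. It
    holds trivially at [h = 0], so [0 < enorm h] is required separately when whole sets are
    measured. *)
Definition jump u (lam : R) x h : bool :=
  lam * enorm h ^+ N.+1 <= `|u (x + h) - u x|.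

Definition jump_measure u lam h : \bar R := (\int[mu]_x (jump u lam x h)%:R%:E)%E.

Lemma measurable_jump u lam : continuous u ->
  measurable_fun setT (fun z : borel_rV R N * borel_rV R N => jump u lam z.1 z.2).
Proof.
move=> /continuous_measurable_rV mu_u.
apply: measurable_fun_ler.
  apply: measurable_funM => //; apply: measurable_funX.
  exact: (measurableT_comp (@measurable_enorm R N)).
apply: (measurableT_comp (@normr_measurable _ _)); apply: measurable_funB.
  by apply: (measurableT_comp mu_u); exact: measurable_addrV.
exact: (measurableT_comp mu_u).
Qed.

Lemma measurable_jump_measure u lam : continuous u ->
  measurable_fun setT (jump_measure u lam : borel_rV R N -> \bar R).
Proof.
move=> cu; apply: (@measurable_fun_fubini_tonelli_G _ _ _ _ _ mu
  (fun z : borel_rV R N * borel_rV R N => (jump u lam z.1 z.2)%:R%:E)) => //.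
by apply: measurable_fun_bool_natr; exact: measurable_jump.
Qed.

Lemma jump_measure_ge0 u lam h : (0 <= jump_measure u lam h)%E.
Proof. by apply: integral_ge0 => x _; rewrite lee_fin. Qed.

(* Averaging over the translates [x + m e], [m < 2^J], turns the left-hand side
   into the integral over [x] of the sums controlled by [window_sum_le]. *)
Lemma sum_jump_measure_le u lam e J : (0 < N)%N -> continuous u -> 0 < lam ->
  0 < enorm e ->
  (\sum_(0 <= j < J) (2 ^+ (j * N))%:E * jump_measure u lam (2 ^+ j *: e) <=
   (16 / (lam * enorm e ^+ N.+1))%:E * \int[mu]_x `|u ((x : 'rV[R]_N) + e) - u x|%:E)%E.
Proof.
move=> N0 cu lam0 e0.
(* With this [nu], the threshold for a jump along [2 ^+ j *: e] is [nu * 2 ^+ (j * N.+1)], the form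
   used in [window_sum_le]. *)
set nu := lam * enorm e ^+ N.+1; set I := (\int[mu]_x _)%E.
have nu0 : 0 < nu by rewrite mulr_gt0// exprn_gt0.
pose pt (x : 'rV[R]_N) i := x + i%:R *: e.
pose v (x : 'rV[R]_N) i := `|u (pt x i.+1) - u (pt x i)|.
have ptD x i k : pt (pt x i) k = pt x (i + k)%N by rewrite /pt -addrA -scalerDl natrD.
have jumpE x j m : jump u lam (pt x m) (2 ^+ j *: e) =
    (nu * 2 ^+ (j * N.+1) <= `|u (pt x (m + 2 ^ j)%N) - u (pt x m)|).
  rewrite /jump enormZ ?exprn_ge0// exprMn -exprM mulrCA mulrC -/nu.
  by rewrite -ptD /pt natrX.
have mpt i : measurable_fun setT (fun x : borel_rV R N => pt x i : borel_rV R N).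
  exact: measurable_translation.
have mjump j m : measurable_fun setT
    (fun x : borel_rV R N => (jump u lam (pt x m) (2 ^+ j *: e))%:R%:E : \bar R).
  apply: measurable_fun_bool_natr.
  apply: (measurableT_comp (measurable_jump lam cu)
    (g := fun x : borel_rV R N => (pt x m : borel_rV R N, 2 ^+ j *: e : borel_rV R N))).
  exact: measurable_fun_pair.
have mv i : measurable_fun setT (fun x : borel_rV R N => (v x i)%:E).
  apply/measurable_EFinP; apply: (measurableT_comp (@normr_measurable _ _)).
  by apply: measurable_funB; exact: (measurableT_comp (continuous_measurable_rV cu)).
have transl j m : jump_measure u lam (2 ^+ j *: e) =
    (\int[mu]_x (jump u lam (pt x m) (2 ^+ j *: e))%:R%:E)%E.
  have := mjump j 0%N; rewrite /jump_measure => mj0.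
  rewrite -(ge0_integral_translation (m%:R *: e)
    (f := fun x => (jump u lam x (2 ^+ j *: e))%:R%:E))//.
  by move: mj0; apply: eq_measurable_fun => x _; rewrite /pt scale0r addr0.
have Iv i : (\int[mu]_x (v x i)%:E = I)%E.
  rewrite /I -[RHS](ge0_integral_translation (i%:R *: e)).
  - apply: eq_integral => x _; by rewrite /v /pt -natr1 scalerDl scale1r addrA.
  - have := mv 0%N; apply: eq_measurable_fun => x _.
    by rewrite /v/pt scale0r scale1r addr0.
  - by [].
have J0 : 0 < 2 ^+ J :> R by rewrite exprn_gt0.
rewrite -(@lee_pmul2l _ (2 ^+ J)%:E)//.
rewrite ge0_sume_distrr; last first.
  by move=> j _; rewrite mule_ge0 ?jump_measure_ge0// lee_fin exprn_ge0.
have term0 j m x : (0 <= (2 ^+ (j * N))%:E *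
    (jump u lam (pt x m) (2 ^+ j *: e))%:R%:E :> \bar R)%E.
  by rewrite mule_ge0 ?lee_fin// exprn_ge0.
have mterm j m : measurable_fun setT (fun x : borel_rV R N => (2 ^+ (j * N))%:E *
    (jump u lam (pt x m) (2 ^+ j *: e))%:R%:E : \bar R)%E.
  exact: measurable_funeM.
have -> : (\sum_(0 <= j < J) (2 ^+ J)%:E *
     ((2 ^+ (j * N))%:E * jump_measure u lam (2 ^+ j *: e)) =
   \int[mu]_x (\sum_(0 <= j < J) \sum_(0 <= m < 2 ^ J)
     (2 ^+ (j * N))%:E * (jump u lam (pt x m) (2 ^+ j *: e))%:R%:E))%E.
  rewrite ge0_integral_sum//; last 2 first.
    by move=> j; exact: emeasurable_sum.
    by move=> j x _; apply: sume_ge0 => m _; exact: term0.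
  apply: eq_bigr => j _; rewrite ge0_integral_sum//.
  under eq_bigr => m _.
    rewrite ge0_integralZl// -transl; over.
  by rewrite ge0_sume_const_nat ?natrX// mule_ge0 ?jump_measure_ge0.
have c0 : (0 <= (8 / nu)%:E)%E by rewrite lee_fin divr_ge0// ltW.
apply: (@le_trans _ _ (\int[mu]_x \sum_(0 <= i < 2 ^ J.+1) (8 / nu)%:E * (v x i)%:E)%E).
  apply: ge0_le_integral => //.
  - by move=> x _; apply: sume_ge0 => j _; apply: sume_ge0 => m _; exact: term0.
  - by apply: emeasurable_sum => j; exact: emeasurable_sum.
  - by apply: emeasurable_sum => ?; exact: measurable_funeM.
  move=> x _.
  under eq_bigr do (under eq_bigr do rewrite -EFinM; rewrite sumEFin).
  under [leRHS]eq_bigr do rewrite -EFinM.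
  rewrite !sumEFin lee_fin -mulr_sumr.
  apply: le_trans; last exact: (window_sum_le J N0 nu0 (fun i => normr_ge0 _ : 0 <= v x i)).
  apply: ler_sum => j _; apply: ler_sum => m _; rewrite jumpE.
  have [le|_] := boolP (nu * _ <= `|_|); last by rewrite mulr0; case: ifP; rewrite ?exprn_ge0.
  rewrite mulr1 ifT//; apply: le_trans le _.
  (* A jump across [2 ^ j] steps is at most the mass of [v x] in the window that starts at [m]. *)
  rewrite -(telescope_sumr (fun i => u (pt x i))) ?leq_addr//.
  exact: ler_norm_sum.
rewrite ge0_integral_sum//; last 2 first.
- by move=> i; exact: measurable_funeM.
- by move=> i x _; rewrite mule_ge0// lee_fin normr_ge0.
have v0 i x : [set: borel_rV R N] x -> (0 <= (v x i)%:E)%E by rewrite lee_fin normr_ge0.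
rewrite (eq_bigr (fun=> (8 / nu)%:E * I)%E); last first.
  move=> i _; rewrite ge0_integralZl//; last exact: v0.
  by congr (_ * _)%E; exact: Iv.
rewrite ge0_sume_const_nat; last by rewrite mule_ge0// integral_ge0.
(* All [2 ^ J.+1] terms integrate to [I]; against the factor [2 ^+ J] on the left, the constant 8
   becomes 16. *)
rewrite natrX !muleA -!EFinM exprS.
by rewrite (_ : 2 * _ * (8 / nu) = 2 ^+ J * (16 / nu))//; field; exact: lt0r_neq0.
Qed.

(** Either [t] is below [2 ^+ J * r] and an earlier scale contains it, or it falls in the last one.
    The indicator form is the one used under the integral. *)
Lemma dyadic_scales (r t : R) J : 0 < r ->
  (r <= t < 2 ^+ J * r)%R%:R <=
  \sum_(0 <= j < J) (2 ^+ j * r <= t < 2 * (2 ^+ j * r))%R%:R :> R.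
Proof.
move=> r0; elim: J => [|J IH].
  by rewrite big_geq// mul1r; case: (leP r t) => //= ->.
rewrite big_nat_recr//= mulrA -exprS.
have [tJ|tJ] := ltP t (2 ^+ J * r).
  have rJ : 2 ^+ J * r <= 2 ^+ J.+1 * r by rewrite ler_wpM2r ?ler_weXn2l ?ler1n// ltW.
  by move: IH; rewrite tJ (lt_le_trans tJ rJ) ?andbT/= ?addr0.
rewrite ler_wpDl ?sumr_ge0// /=.
by case: (leP r t) => //= _; rewrite ler_nat leqnn.
Qed.

(** Each dyadic annulus is rescaled to [r <= enorm e < 2 * r] by [h = 2 ^+ j *: e], with Jacobian
    [2 ^+ (j * N)], precisely the weight in [sum_jump_measure_le]. The remaining factor
    [enorm e ^- N] compensates the volume of the base annulus, so the bound depends neither on [r]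
    nor on [J]. *)
Lemma integral_jump_measure_le u lam r J : (0 < N)%N -> continuous u ->
  (forall i x, derivable u x (delta_mx ord0 i)) ->
  (forall i, continuous (partial i u)) -> 0 < lam -> 0 < r ->
  (\int[mu]_h ((r <= enorm (h : 'rV[R]_N) < 2 ^+ J * r)%R%:R%:E * jump_measure u lam h) <=
   (16 * N%:R * 4 ^+ N / lam)%:E * gradient_L1 u)%E.
Proof.
move=> N0 cu du cp lam0 r0.
pose ann j h : \bar R := (2 ^+ j * r <= enorm h < 2 * (2 ^+ j * r))%R%:R%:E.
have mann j : measurable_fun setT (ann j : borel_rV R N -> \bar R).
  by apply: measurable_fun_bool_natr; exact: measurable_enorm_itv.
have mphi := measurable_jump_measure lam cu.
have mphis j : measurable_fun setT
    ((fun e => jump_measure u lam (2 ^+ j *: e)) : borel_rV R N -> \bar R).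
  have := measurableT_comp mphi (measurable_affine (2 ^+ j) (0 : 'rV[R]_N)).
  by apply: eq_measurable_fun => h _ /=; rewrite addr0.
have ann0 j h : (0 <= ann j h)%E by rewrite lee_fin.
have G0 : (0 <= gradient_L1 u)%E.
  by apply: integral_ge0 => x _; rewrite lee_fin enorm_ge0.
have scale j : (\int[mu]_h (ann j h * jump_measure u lam h) =
    \int[mu]_h (ann 0%N h * ((2 ^+ (j * N))%:E * jump_measure u lam (2 ^+ j *: h))))%E.
  have p0 : 0 < 2 ^+ j :> R by rewrite exprn_gt0.
  rewrite -(ge0_integral_affine (0 : 'rV[R]_N) p0); last 2 first.
  - exact: emeasurable_funM.
  - by move=> h; rewrite mule_ge0// jump_measure_ge0.
  rewrite -exprM.
  have mf : measurable_fun setT (fun h : borel_rV R N =>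
      ann j (2 ^+ j *: (h : 'rV[R]_N) + 0)%R *
      jump_measure u lam (2 ^+ j *: (h : 'rV[R]_N) + 0)%R)%E.
    apply: emeasurable_funM.
      by apply: (measurableT_comp (mann j)); exact: measurable_affine.
    by apply: (measurableT_comp mphi); exact: measurable_affine.
  rewrite -[LHS](ge0_integralZl mu measurableT mf); last 2 first.
  - by move=> h _; rewrite mule_ge0// jump_measure_ge0.
  - by rewrite lee_fin exprn_ge0.
  apply: eq_integral => h _; rewrite addr0 muleCA; congr (_ * _)%E.
  by rewrite /ann expr0 mul1r enormZ ?exprn_ge0// mulrCA ler_pM2l// ltr_pM2l.
apply: (@le_trans _ _ (\int[mu]_h \sum_(0 <= j < J) (ann j h * jump_measure u lam h))%E).
  apply: ge0_le_integral => //.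
  - by move=> h _; rewrite mule_ge0 ?jump_measure_ge0// lee_fin.
  - apply: emeasurable_funM => //.
    by apply: measurable_fun_bool_natr; exact: measurable_enorm_itv.
  - by apply: emeasurable_sum => j; exact: emeasurable_funM.
  move=> h _; rewrite -ge0_sume_distrl; last by move=> j _; exact: ann0.
  rewrite lee_wpmul2r ?jump_measure_ge0// sumEFin lee_fin; exact: dyadic_scales.
rewrite ge0_integral_sum//; last 2 first.
- by move=> j; exact: emeasurable_funM.
- by move=> j h _; rewrite mule_ge0// jump_measure_ge0.
under eq_bigr do rewrite scale.
rewrite -ge0_integral_sum//; last 2 first.
- by move=> j; apply: emeasurable_funM => //; exact: measurable_funeM.
- by move=> j h _; rewrite mule_ge0// mule_ge0 ?jump_measure_ge0// lee_fin exprn_ge0.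
(* The product of [16 / (lam * enorm h ^+ N.+1)] and the increment bound [N%:R * enorm h], with
   [enorm h] replaced by its lower bound [r]. *)
pose K := 16 * N%:R / (lam * r ^+ N).
have K0 : 0 <= K by rewrite divr_ge0 ?mulr_ge0 ?exprn_ge0// ltW.
apply: (@le_trans _ _ (\int[mu]_h ((K%:E * gradient_L1 u) * ann 0%N h))%E).
  apply: ge0_le_integral => //.
  - move=> h _; apply: sume_ge0 => j _.
    by rewrite mule_ge0// mule_ge0 ?jump_measure_ge0// lee_fin exprn_ge0.
  - apply: emeasurable_sum => j; apply: emeasurable_funM => //.
    exact: measurable_funeM.
  - exact: measurable_funeM.
  move=> h _; rewrite -ge0_sume_distrr; last first.
    by move=> j _; rewrite mule_ge0 ?jump_measure_ge0// lee_fin exprn_ge0.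
  rewrite muleC /ann expr0 mul1r.
  have [/andP[rh _]|_] := boolP (r <= _ < _); last by rewrite !mule0.
  rewrite !mule1.
  have h0 : 0 < enorm h by exact: lt_le_trans rh.
  apply: le_trans (sum_jump_measure_le J N0 cu lam0 h0) _.
  apply: le_trans (lee_wpmul2l _ (integral_increment_le h cu du cp)) _.
    by rewrite lee_fin divr_ge0// mulr_ge0 ?exprn_ge0// ltW.
  rewrite muleA -EFinM lee_wpmul2r// lee_fin.
  rewrite (_ : _ * (N%:R * _) = 16 * N%:R / (lam * enorm h ^+ N)); last first.
    rewrite exprS; have : enorm h ^+ N != 0 by rewrite expf_neq0 ?lt0r_neq0.
    move: (enorm h ^+ N) => p p0; field.
    by rewrite p0 !lt0r_neq0.
  rewrite ler_wpM2l ?mulr_ge0// lef_pV2 ?posrE ?mulr_gt0 ?exprn_gt0//.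
  by rewrite ler_pM2l// lerXn2r// nnegrE ltW.
rewrite ge0_integralZl//; last by rewrite mule_ge0.
rewrite (eq_integral (fun h : borel_rV R N =>
  (r <= enorm (h : 'rV[R]_N) < 2 * r)%R%:R%:E)); last first.
  by move=> h _; rewrite /ann expr0 mul1r.
apply: le_trans (lee_wpmul2l _ (annulus_volume_le N r0)) _; first by rewrite mule_ge0.
rewrite muleAC -EFinM lee_wpmul2r// lee_fin exprMn /K.
rewrite le_eqVlt; apply/orP; left; apply/eqP.
have : r ^+ N != 0 by rewrite expf_neq0 ?lt0r_neq0.
by move: (r ^+ N) (4 ^+ N : R) => p q p0; field; rewrite p0 lt0r_neq0.
Qed.

Lemma measurable_difference_quotient (a : R) u : continuous u ->
  measurable_fun setT (difference_quotient a u).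
Proof.
move=> /continuous_measurable_rV mu_u; rewrite /difference_quotient.
under eq_fun do rewrite -powRN.
apply: measurable_funM.
  by apply: measurable_funB; apply: (measurableT_comp mu_u).
apply: (measurableT_comp (@measurable_powR R (- a))).
apply: (measurableT_comp (@measurable_enorm R N)).
apply: measurable_fun_rV => i; under eq_fun do rewrite !mxE.
by apply: measurable_funB; apply: (measurableT_comp (measurable_coord i)).
Qed.

Lemma exists_dyadic_bounds (t : R) : 0 < t -> exists n, (2 ^+ n)^-1 <= t < 2 ^+ n.
Proof.
move=> t0; have powgt (x : R) m : 0 <= x -> (Num.bound x <= m)%N -> x < 2 ^+ m.
  move=> x0 xm; apply: lt_le_trans (archi_boundP x0) _.
  by rewrite -natrX ler_nat (leq_trans xm)// ltnW// ltn_expl.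
exists (maxn (Num.bound t) (Num.bound t^-1)).
apply/andP; split; last by apply: powgt; [exact: ltW|exact: leq_maxl].
rewrite -[leRHS]invrK lef_pV2 ?posrE ?invr_gt0 ?exprn_gt0//.
by apply/ltW/powgt; [rewrite invr_ge0 ltW|exact: leq_maxr].
Qed.

(** Continuity from below: the annuli between [2^-n] and [2^n] exhaust the nonzero [h], and the
    bound on them is uniform in [n]. *)
Lemma jump_set_le u lam : (0 < N)%N -> continuous u ->
  (forall i x, derivable u x (delta_mx ord0 i)) ->
  (forall i, continuous (partial i u)) -> 0 < lam ->
  ((mu \x mu) [set z | (0 < enorm (z.2 : 'rV[R]_N))%R && jump u lam z.1 z.2] <=
   (16 * N%:R * 4 ^+ N / lam)%:E * gradient_L1 u)%E.
Proof.
move=> N0 cu du cp lam0.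
(* The outer radius [2^n] is written so as to match [integral_jump_measure_le] with [r = 2^-n] and
   [J = n + n]. *)
pose b n (z : borel_rV R N * borel_rV R N) :=
  ((2 ^+ n)^-1 <= enorm (z.2 : 'rV[R]_N) < 2 ^+ (n + n) * (2 ^+ n)^-1) && jump u lam z.1 z.2.
have pow0 n : 0 < 2 ^+ n :> R by rewrite exprn_gt0.
have bE n z : b n z =
    ((2 ^+ n)^-1 <= enorm (z.2 : 'rV[R]_N) < 2 ^+ n) && jump u lam z.1 z.2.
  by rewrite /b exprD mulfK// lt0r_neq0.
have mb n : measurable_fun setT (b n).
  apply: measurable_and; last exact: measurable_jump.
  by apply: (measurableT_comp (measurable_enorm_itv _ _)).
have mF n := measurable_set_bool (mb n).
have -> : [set z | (0 < enorm (z.2 : 'rV[R]_N)) && jump u lam z.1 z.2] =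
    \bigcup_n [set z | b n z].
  apply/seteqP; split => z /=.
    move=> /andP[/exists_dyadic_bounds[n zn] zj].
    by exists n => //=; rewrite bE zn.
  move=> [n _] /=; rewrite bE => /andP[/andP[zn _] ->]; rewrite andbT.
  by apply: lt_le_trans zn; rewrite invr_gt0.
have ndF : {homo (fun n => [set z | b n z]) : n m / (n <= m)%N >-> (n <= m)%O}.
  move=> m n mn; apply/subsetPset => z /=; rewrite !bE => /andP[/andP[zm zm'] ->].
  have pmn : 2 ^+ m <= 2 ^+ n :> R by rewrite ler_weXn2l// ler1n.
  rewrite andbT (lt_le_trans zm')// andbT (le_trans _ zm)//.
  by rewrite lef_pV2 ?posrE.
have cv := @nondecreasing_cvg_mu _ _ _ (mu \x mu)%E _ mF
  (bigcup_measurable (fun n _ => mF n)) ndF.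
rewrite -(cvg_lim _ cv)//.
apply: lime_le; first exact: cvgP cv.
apply: nearW => n /=.
rewrite -integral_set_bool// fubini_tonelli2//; last exact: measurable_fun_bool_natr.
rewrite /fubini_G.
have r0 : 0 < (2 ^+ n)^-1 :> R by rewrite invr_gt0.
apply: le_trans (integral_jump_measure_le (n + n) N0 cu du cp lam0 r0).
rewrite le_eqVlt; apply/orP; left; apply/eqP/eq_integral => h _.
rewrite -ge0_integralZl//.
  by apply: eq_integral => x _; rewrite /b/= -mulnb natrM EFinM.
apply: measurable_fun_bool_natr.
apply: (measurableT_comp (measurable_jump lam cu)
  (g := fun x : borel_rV R N => (x, h) : borel_rV R N * borel_rV R N)).
exact: measurable_fun_pair.
Qed.

(** For fixed [x], the substitution [y = h + x] turns the superlevel set of the quotient into the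
    jump set. *)
Lemma weak_type_difference_quotient u lam : (0 < N)%N -> continuous u ->
  (forall i x, derivable u x (delta_mx ord0 i)) ->
  (forall i, continuous (partial i u)) -> 0 < lam ->
  ((mu \x mu) [set z | lam <= `|difference_quotient (N%:R + 1) u z|]%R <=
   (16 * N%:R * 4 ^+ N / lam)%:E * gradient_L1 u)%E.
Proof.
move=> N0 cu du cp lam0; apply: le_trans (jump_set_le N0 cu du cp lam0).
have mq := measurable_difference_quotient (N%:R + 1) cu.
have mb : measurable_fun setT (fun z => lam <= `|difference_quotient (N%:R + 1) u z|).
  by apply: measurable_fun_ler => //; exact: (measurableT_comp (@normr_measurable _ _)).
have mj : measurable_fun setT (fun z : borel_rV R N * borel_rV R N =>
    (0 < enorm (z.2 : 'rV[R]_N)) && jump u lam z.1 z.2).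
  apply: measurable_and; last exact: measurable_jump.
  by apply: measurable_fun_ltr => //; exact: (measurableT_comp (@measurable_enorm R N)).
rewrite -!integral_set_bool//.
rewrite !fubini_tonelli1//; [|exact: measurable_fun_bool_natr..].
rewrite le_eqVlt; apply/orP; left; apply/eqP/eq_integral => x _.
rewrite /fubini_F -(ge0_integral_translation x
  (f := fun y => (lam <= `|difference_quotient (N%:R + 1) u (x, y)|)%R%:R%:E))//; last first.
  apply: measurable_fun_bool_natr.
  by apply: (measurableT_comp mb (g := fun y => (x, y))); exact: measurable_fun_pair.
apply: eq_integral => h _; congr (nat_of_bool _)%:R%:E.
rewrite /difference_quotient/= (_ : (x : 'rV[R]_N) - (h + x) = - h); last first.
  by rewrite opprD addrCA subrr addr0.
rewrite enormN natr1 powR_mulrn ?enorm_ge0//.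
rewrite normrM distrC [h + x]addrC normfV (ger0_norm (exprn_ge0 _ (enorm_ge0 _))) /jump.
(* At [h = 0] both conditions fail: the inverse of 0 is 0, so the quotient is below [lam], and
   [0 < enorm h] is false. *)
have := enorm_ge0 h; rewrite le_eqVlt => /predU1P[<-|h0].
  by rewrite ltxx expr0n invr0 mulr0 leNgt lam0.
by rewrite h0 ler_pdivlMr// exprn_gt0.
Qed.

End weak_type_estimate.

(** * Interpolation between two weak-type bounds *)

Section marcinkiewicz_interpolation.
Context d (T : measurableType d) (R : realType) (m : {measure set T -> \bar R}).
Implicit Types f g : T -> R.

Lemma measurable_superlevel f (a : R) : measurable_fun setT f ->
  measurable [set z | a <= `|f z|].
Proof.
move=> mf; apply: measurable_set_bool; apply: measurable_fun_ler => //.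
exact: (measurableT_comp (@normr_measurable _ _)).
Qed.

Lemma superlevel_null f : measurable_fun setT f ->
  (forall a, 0 < a -> m [set z | a <= `|f z|] = 0%E) -> m.-negligible [set z | f z != 0].
Proof.
move=> mf f0.
have mF (n : nat) := measurable_superlevel n.+1%:R^-1 mf.
have -> : [set z | f z != 0] = \bigcup_n [set z | n.+1%:R^-1 <= `|f z|].
  apply/seteqP; split => z /=.
    rewrite -normr_gt0 => fz; have [n _ /(_ n)] := near_infty_natSinv_lt (PosNum fz).
    by move=> /(_ (leqnn n)) /= /ltW ?; exists n.
  by move=> [n _] /=; rewrite -normr_gt0; apply: lt_le_trans; rewrite invr_gt0.
by apply: negligible_bigcup => n; apply/negligibleP => //; apply: f0; rewrite invr_gt0.
Qed.

(** If [al]^ theta * be [^ (1 - theta) = lam], then [|f| >= lam] forces [|f1| >= al] or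
    [|f2| >= be]. The levels are chosen so that both sets get the same bound [M]. *)
Lemma marcinkiewicz_interpolation f f1 f2 (p p1 theta : R) (A B : \bar R) :
  measurable_fun setT f -> measurable_fun setT f1 -> measurable_fun setT f2 ->
  0 < theta < 1 -> 1 < p1 -> 1 < p -> p^-1 = theta / p1 + (1 - theta) ->
  (forall z, `|f z| = `|f1 z| `^ theta * `|f2 z| `^ (1 - theta)) ->
  (0 <= A)%E -> (0 <= B)%E ->
  (forall a, 0 < a -> ((a `^ p1)%:E * m [set z | a <= `|f1 z|]%R <= A)%E) ->
  (forall a, 0 < a -> (a%:E * m [set z | a <= `|f2 z|]%R <= B)%E) ->
  (marcinkiewicz m p f <= 2%:E * (A `^ p1^-1) `^ theta * B `^ (1 - theta)%R)%E.
Proof.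
move=> mf mf1 mf2 /andP[th0 th1] p11 p_1 pE fE A0 B0 HA HB.
have p0 : 0 < p by lra.
have p10 : 0 < p1 by lra.
have th'0 : 0 < 1 - theta by lra.
set X := (2%:E * _ * _)%E.
have X0 : (0 <= X)%E by rewrite !mule_ge0// poweR_ge0.
suff H lam : 0 < lam -> ((lam `^ p)%:E * m [set z | lam <= `|f z|]%R <= X `^ p)%E.
  rewrite /marcinkiewicz -[leRHS]poweRe1// -(divff (lt0r_neq0 p0)) poweRrM.
  apply: gt0_ler_poweR.
  - by rewrite invr_ge0 ltW.
  - rewrite in_itv/= leey andbT; apply: le_trans (ereal_sup_ubound _); last by exists 1 => //=.
    by rewrite mule_ge0// lee_fin powR_ge0.
  - by rewrite in_itv/= leey andbT poweR_ge0.
  - by apply: ub_ereal_sup => _ [lam /= lam0 <-]; exact: H.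
move=> lam0.
(* If [A] or [B] is 0, then [X] is 0 even when the other is infinite, so [f] has to vanish almost
   everywhere. It does, because one of its factors does. *)
have null_case g : measurable_fun setT g -> (forall z, g z = 0 -> f z = 0) ->
    (forall a, 0 < a -> m [set z | a <= `|g z|] = 0%E) ->
    ((lam `^ p)%:E * m [set z | lam <= `|f z|]%R <= X `^ p)%E.
  move=> mg gf /(superlevel_null mg) g0.
  rewrite (_ : m _ = 0%E) ?mule0 ?poweR_ge0//.
  apply: measure_negligible; first exact: measurable_superlevel.
  apply: negligibleS g0 => z /= lz.
  by apply: contraTneq lz => /gf ->; rewrite normr0 -ltNge.
have [A00|An0] := eqVneq A 0%E.
  apply: (null_case f1) => // [z z0|a a0].
    by apply/eqP; rewrite -normr_eq0 fE z0 normr0 powR0 ?mul0r// lt0r_neq0.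
  have := HA a a0; rewrite A00 => H; apply/eqP; rewrite eq_le measure_ge0 andbT.
  by move: H; rewrite pmule_rle0// lte_fin powR_gt0.
have [B00|Bn0] := eqVneq B 0%E.
  apply: (null_case f2) => // [z z0|a a0].
    by apply/eqP; rewrite -normr_eq0 fE z0 normr0 (powR0 (lt0r_neq0 th'0)) mulr0.
  have := HB a a0; rewrite B00 => H; apply/eqP; rewrite eq_le measure_ge0 andbT.
  by move: H; rewrite pmule_rle0.
have Ap : (0 < (A `^ p1^-1) `^ theta)%E by rewrite !poweR_gt0// lt0e An0.
have Bp : (0 < B `^ (1 - theta)%R)%E by rewrite !poweR_gt0// lt0e Bn0.
have Xoo : X = +oo%E -> ((lam `^ p)%:E * m [set z | lam <= `|f z|]%R <= X `^ p)%E.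
  by move=> ->; rewrite poweRyr ?leey// lt0r_neq0.
case: A A0 An0 HA @X X0 null_case Ap Xoo => [a| |//] A0 An0 HA X X0 _ Ap Xoo; last first.
  apply: Xoo; rewrite /X !poweRyr ?invr_neq0 ?lt0r_neq0//.
  by rewrite gt0_muley// gt0_mulye.
case: B B0 Bn0 HB @X X0 Bp Xoo => [b| |//] B0 Bn0 HB X X0 Bp Xoo; last first.
  apply: Xoo; rewrite /X (poweRyr (lt0r_neq0 th'0))//.
  by rewrite gt0_muley// mule_gt0.
have a0 : 0 < a by rewrite lt0r -eqe An0 -lee_fin.
have b0 : 0 < b by rewrite lt0r -eqe Bn0 -lee_fin.
clear Xoo Ap Bp X0 A0 B0 An0 Bn0.
pose D := a `^ (theta / p1) * b `^ (1 - theta).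
have D0 : 0 < D by rewrite mulr_gt0// powR_gt0.
have XE : X = (2 * D)%:E.
  by rewrite /X !poweR_EFin -!EFinM -powRrM [_^-1 * _]mulrC mulrA.
pose M := (D / lam) `^ p.
have M0 : 0 < M by rewrite powR_gt0// divr_gt0.
pose al := (a / M) `^ p1^-1; pose be := b / M.
have al0 : 0 < al by rewrite powR_gt0// divr_gt0.
have be0 : 0 < be by rewrite divr_gt0.
have albe : al `^ theta * be `^ (1 - theta) = lam.
  rewrite /al /be -powRrM [_^-1 * _]mulrC !powRM ?invr_ge0 ?ltW//.
  rewrite mulrACA -/D -(powR_inv1 (ltW M0)) -!(powRrM M) -powRD; last first.
    by apply/implyP => _; rewrite lt0r_neq0.
  rewrite (_ : -1 * _ + _ = - p^-1); last by rewrite pE; ring.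
  rewrite /M -powRrM mulrN divff ?lt0r_neq0// powRN powRr1 ?divr_ge0 ?ltW//.
  by field; rewrite !lt0r_neq0.
have sub : [set z | lam <= `|f z|] `<=` [set z | al <= `|f1 z|] `|` [set z | be <= `|f2 z|].
  move=> z /=; have [|z1] := leP al `|f1 z|; first by left.
  have [|z2] := leP be `|f2 z|; first by right.
  rewrite leNgt fE -albe ltr_pM ?powR_ge0//.
  - by apply: gt0_ltr_powR; rewrite ?nnegrE// ltW.
  - by apply: gt0_ltr_powR; rewrite ?nnegrE// ltW.
have mS1 := measurable_superlevel al mf1.
have mS2 := measurable_superlevel be mf2.
have S1 : (m [set z | al <= `|f1 z|]%R <= M%:E)%E.
  have aM0 : 0 < a / M by rewrite divr_gt0.
  have -> : M%:E = ((a / M)^-1%:E * a%:E)%E.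
    by rewrite -EFinM invf_div mulfVK// lt0r_neq0.
  rewrite lee_pdivlMl// (_ : a / M = al `^ p1); first exact: HA.
  by rewrite /al -powRrM mulVf ?lt0r_neq0// powRr1// ltW.
have S2 : (m [set z | be <= `|f2 z|]%R <= M%:E)%E.
  have -> : M%:E = (be^-1%:E * b%:E)%E.
    by rewrite -EFinM invf_div mulfVK// lt0r_neq0.
  by rewrite lee_pdivlMl//; exact: HB.
have SM : (m [set z | lam <= `|f z|]%R <= (2 * M)%:E)%E.
  apply: le_trans (le_measure m _ _ sub) _; rewrite ?inE.
  - exact: measurable_superlevel.
  - exact: measurableU.
  apply: le_trans (measureU2 _ mS1 mS2) _.
  by rewrite mulr2n mulrDl mul1r EFinD leeD.
apply: le_trans (lee_wpmul2l _ SM) _; first by rewrite lee_fin powR_ge0.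
rewrite -EFinM XE poweR_EFin lee_fin mulrCA.
rewrite -(powRM _ (ltW lam0) (divr_ge0 (ltW D0) (ltW lam0))).
rewrite mulrC [lam * _]mulrC divfK ?lt0r_neq0// powRM// ?(ltW D0)//.
rewrite mulrC ler_wpM2r ?powR_ge0//.
by rewrite -[leLHS]powRr1// ler_powR ?ler1n// ltW.
Qed.

End marcinkiewicz_interpolation.

(** * Factorisation of the quotient and the Gagliardo endpoint *)

Section difference_quotients.
Context (R : realType) (N : nat).
Implicit Types u : 'rV[R]_N -> R.
Local Notation mu := (lebesgue_rV R N).

Lemma normr_difference_quotient (a : R) u z :
  `|difference_quotient a u z| = `|u z.1 - u z.2| * enorm (z.1 - z.2) `^ (- a).
Proof. by rewrite normrM -powRN (ger0_norm (powR_ge0 _ _)). Qed.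

Lemma difference_quotient_interpolation (a b theta : R) u z :
  0 < theta < 1 -> 0 < a -> 0 < b ->
  `|difference_quotient (theta * a + (1 - theta) * b) u z| =
  `|difference_quotient a u z| `^ theta * `|difference_quotient b u z| `^ (1 - theta).
Proof.
move=> /andP[th0 th1] a0 b0; rewrite !normr_difference_quotient.
rewrite !powRM ?powR_ge0// mulrACA -powRD; last first.
  by rewrite addrC subrK oner_eq0.
rewrite -!powRrM -powRD; last first.
  (* On the diagonal the base is 0, where adding exponents is valid only if their sum is nonzero;
     here the sum is negative. *)
  have : 0 < a * theta by rewrite mulr_gt0.
  have : 0 < b * (1 - theta) by rewrite mulr_gt0// subr_gt0.
  by move=> ? ?; apply/implyP => /eqP; lra.
rewrite [theta + _]addrC subrK powRr1//; congr (_ * _ `^ _); ring.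
Qed.

(** Chebyshev's inequality: the [p1]-th power of the quotient with exponent [N%:R / p1 + s1] is
    exactly the Gagliardo integrand. *)
Lemma gagliardo_chebyshev (s1 p1 al : R) u : continuous u -> 0 < p1 -> 0 < al ->
  ((al `^ p1)%:E *
     (mu \x mu) [set z | al <= `|difference_quotient (N%:R / p1 + s1) u z|]%R <=
   \int[mu \x mu]_z
     (`|u z.1 - u z.2| `^ p1 / enorm (z.1 - z.2) `^ (N%:R + s1 * p1))%:E)%E.
Proof.
move=> cu p10 al0; set q := difference_quotient _ u.
have mq : measurable_fun setT q by exact: measurable_difference_quotient.
have mnq : measurable_fun setT (fun z => `|q z|).
  exact: (measurableT_comp (@normr_measurable _ _)).
have mb : measurable_fun setT (fun z => al <= `|q z|) by exact: measurable_fun_ler.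
rewrite -integral_set_bool// -ge0_integralZl//; last 2 first.
- exact: measurable_fun_bool_natr.
- by rewrite lee_fin powR_ge0.
have -> : (fun z : borel_rV R N * borel_rV R N =>
    (`|u z.1 - u z.2| `^ p1 / enorm (z.1 - z.2) `^ (N%:R + s1 * p1))%:E) =
    (fun z => (`|q z| `^ p1)%:E).
  apply/funext => z; congr EFin.
  rewrite normr_difference_quotient powRM ?powR_ge0// -powRrM -powRN.
  by congr (_ * _ `^ _); field; exact: lt0r_neq0.
apply: ge0_le_integral => //.
- by move=> z _; rewrite mule_ge0// lee_fin powR_ge0.
- by apply: measurable_funeM; exact: measurable_fun_bool_natr.
- by apply/measurable_EFinP; exact: (measurableT_comp (@measurable_powR R p1)).
move=> z _; rewrite -EFinM lee_fin.
have [qz|_] := boolP (al <= _); last by rewrite mulr0 powR_ge0.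
by rewrite mulr1 ge0_ler_powR ?nnegrE// ltW.
Qed.

End difference_quotients.

(** * Assembly of the two endpoint bounds *)

Theorem corollary5p2 (R : realType) (N : nat) (N1 : (1 <= N)%N) :
  exists C : R, forall s1 p1 theta : R,
    0 < s1 < 1 -> 1 < p1 -> 1 <= s1 * p1 -> 0 < theta < 1 ->
    forall s p : R,
      s = theta * s1 + (1 - theta) ->
      p^-1 = theta / p1 + (1 - theta) ->
      [/\ 0 < s < 1, 1 < p &
        forall u : 'rV[R]_N -> R, Cc_infty u ->
          (marcinkiewicz (lebesgue_rV R N \x lebesgue_rV R N) p
             (difference_quotient (N%:R / p + s) u)
           <= C%:E * gagliardo s1 p1 u `^ theta
                   * gradient_L1 u `^ (1 - theta)%R)%E].
Proof.
pose K : R := 16 * N%:R * 4 ^+ N.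
have K1 : 1 <= K.
  have NR1 : 1 <= N%:R :> R by rewrite ler1n.
  have : 1 <= 4 ^+ N :> R by rewrite exprn_ege1// ler1n.
  by rewrite /K; nra.
exists (2 * K) => s1 p1 theta /andP[s10 s11] p11 _ thetaP s p sE pE.
have /andP[th0 th1] := thetaP.
have p10 : 0 < p1 by lra.
have tp1 : 0 < theta / p1 < theta.
  by rewrite divr_gt0//= gtr_pMr// invf_lt1.
have pV : 0 < p^-1 < 1 by lra.
have p_1 : 1 < p by move: pV; rewrite invr_gt0 => /andP[p0]; rewrite invf_lt1.
split=> //; first by rewrite sE; nra.
move=> u [smooth_u _].
have cu : continuous u by have [] := smooth_u [::].
have du i x : derivable u x (delta_mx ord0 i) by have [_] := smooth_u [::]; exact.
have cp i : continuous (partial i u) by have [] := smooth_u [:: i].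
have mq a := measurable_difference_quotient a cu.
have G0 : (0 <= gradient_L1 u)%E.
  by apply: integral_ge0 => x _; rewrite lee_fin enorm_ge0.
(* The relations for [s] and [p] make the exponent the convex combination of the two endpoint
   exponents, as the factorisation of the quotient requires. *)
have exponent : N%:R / p + s = theta * (N%:R / p1 + s1) + (1 - theta) * (N%:R + 1).
  by rewrite pE sE; ring.
have Np1 : 0 < N%:R / p1 + s1 by rewrite addr_gt0// divr_gt0// ltr0n.
have := @marcinkiewicz_interpolation _ _ R (lebesgue_rV R N \x lebesgue_rV R N)%E _ _ _
  p p1 theta _ (K%:E * gradient_L1 u)%E
  (mq (N%:R / p + s)) (mq (N%:R / p1 + s1)) (mq (N%:R + 1)) thetaP p11 p_1 pE _ _ _
  (fun al => gagliardo_chebyshev s1 cu p10).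
move=> H; apply: le_trans (H _ _ _ _) _.
- by move=> z; rewrite exponent difference_quotient_interpolation// addr_gt0// ltr0n.
- by apply: integral_ge0 => z _; rewrite lee_fin divr_ge0// powR_ge0.
- by rewrite mule_ge0// lee_fin (le_trans ler01).
- move=> be be0; rewrite muleC -lee_pdivlMr//.
  apply: le_trans (weak_type_difference_quotient N1 cu du cp be0) _.
  by rewrite -/K muleAC EFinM.
rewrite -/(gagliardo s1 p1 u) poweRM//; last by rewrite lee_fin (le_trans ler01).
rewrite poweR_EFin EFinM muleA (muleAC 2%:E).
rewrite !lee_wpmul2r ?poweR_ge0// lee_wpmul2l// lee_fin ler1_powR//; lra.
Qed.
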